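(* Let $v \geq t$ be positive integers, let $X$ be an $\mathsf{SCA}(t!;t,v)$, let $0<a<t$, and let $m_0,\dots,m_a$ be non-negative integers that sum to $v-a$. Then, across all the arrays in $\mathcal{C}_a(X)$, there are exactly $t!$ rows with multiplicity vector $(m_0,\dots,m_a)$ (rows counted with multiplicity, over all arrays in the multiset $\mathcal{C}_a(X)$).
   Context: For a positive integer $v$, let $[v] = \{0,\dots,v-1\}$ and let $\mathcal{S}_v$ be the set of permutations of $[v]$, in one-line notation $\pi(0)\pi(1)\cdots\pi(v-1)$. A permutation $\pi \in \mathcal{S}_v$ covers a sequence $(s_0,\dots,s_{m-1})$ of distinct elements of $[v]$ if $\pi^{-1}(s_i)<\pi^{-1}(s_{i+1})$ for $0\leq i\leq m-2$. A sequence covering array $\mathsf{SCA}(N;t,v)$, $v\geq t$, is a set $X$ of $N$ permutations in $\mathcal{S}_v$ such that every sequence of $t$ distinct elements of $[v]$ is covered by at least one $\pi\in X$. Construction of $\mathcal{C}_a(X)$: given an $\mathsf{SCA}(N;t,v)$ $X$ and $0<a<t$, choose a set $A$ of $a$ symbols of $[v]$ and a permutation (ordering) $u$ of the symbols of $A$. Let $X_u$ be the set of permutations in $X$ that cover $u$. Let $\mathsf{C}$ be the $|X_u|\times(v-a)$ array with rows indexed by the permutations in $X_u$ and columns indexed by the symbols in $[v]\setminus A$, where the entry in row $\rho$ and column $\nu$ is the number of symbols of $A$ that precede $\nu$ in the permutation $\rho$ (so entries lie in $\{0,\dots,a\}$). $\mathcal{C}_a(X)$ is the multiset of the $v!/(v-a)!$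 arrays obtained in this way over all choices of $A$ and $u$. For a row $\rho$ of an array in $\mathcal{C}_a(X)$, the multiplicity vector of $\rho$ is $(m_0,\dots,m_a)$, where $m_i$ is the number of times the symbol $i$ appears in $\rho$. *)

(* Defs.v *)
From mathcomp Require Import all_boot all_fingroup.

Set Implicit Arguments.
Unset Strict Implicit.
Unset Printing Implicit Defensive.

(* A permutation [pi : 'S_v] is read in one-line notation pi(0) ... pi(v-1),   *)
(* so [(pi^-1)%g x] is the position of the symbol [x] in [pi].                 *)

Definition precedes (v : nat) (pi : 'S_v) : rel 'I_v :=
  [rel x y | (pi^-1)%g x < (pi^-1)%g y].

Definition covers (v : nat) (pi : 'S_v) (s : seq 'I_v) : bool :=
  sorted (precedes pi) s.

Definition is_SCA (N t v : nat) (X : {set 'S_v}) : Prop :=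
  #|X| = N /\
  forall s : t.-tuple 'I_v, uniq s -> exists2 pi, pi \in X & covers pi s.

Record array := Array {
  row_index : finType;
  col_index : finType;
  entry : row_index -> col_index -> nat
}.

Section Derived.

Variables (v : nat) (X : {set 'S_v}).

Definition covering (u : seq 'I_v) : {set 'S_v} := [set pi in X | covers pi u].

Definition derived_array (A : {set 'I_v}) (u : seq 'I_v) : array :=
  @Array {rho : 'S_v | rho \in covering u} {nu : 'I_v | nu \in ~: A}
    (fun rho nu => #|[set x in A | precedes (val rho) x (val nu)]|).

(* The multiset C_a(X), as a list in which equal arrays may be repeated.       *)
Definition derived_arrays (a : nat) : seq array :=
  [seq derived_array A u | A <- enum [set A : {set 'I_v} | #|A| == a],
                           u <- permutations (enum A)].

End Derived.

Definition multiplicity_vector (a : nat) (C : array) (rho : row_index C) :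
    {ffun 'I_a.+1 -> nat} :=
  [ffun i : 'I_a.+1 => #|[set nu : col_index C | entry rho nu == i]|].

(* Main.v *)
Require Import Defs.
From mathcomp Require Import all_boot all_fingroup.

Set Implicit Arguments.
Unset Strict Implicit.
Unset Printing Implicit Defensive.

(** Fix a permutation [pi] of the [v] symbols.  Choosing [A] and an ordering of
    [A] that [pi] covers amounts to choosing [A] alone, because [pi] covers one
    ordering of [A]: the one in which it lists [A]
    ([count_covers_permutations]).  The row that [pi] contributes to the
    resulting array then has as multiplicity vector the lengths of the [a + 1]
    gaps that the symbols of [A] cut out of the word [pi].

    A choice of [a] positions in a word of length [v] is the same thing as its
    vector of gap lengths: the position of the chosen symbol of rank [k] is [k]
    plus the lengths of the gaps [0, ..., k] ([position_of_marked]).  So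
    exactly one [A] yields the prescribed vector ([card_gaps_eq1]).  Exchanging
    the sum over the pairs ([A], ordering) with the sum over [X], every
    permutation of [X] contributes exactly one row, and [#|X|] is [t!]. *)

Lemma card_set_sig (T : finType) (P Q : pred T) :
  #|[set x : {x | P x} | Q (val x)]| = #|[set x | P x && Q x]|.
Proof.
rewrite -(card_imset _ val_inj); apply: eq_card => x; rewrite inE.
apply/imsetP/andP => [[y]|[Px Qx]]; first by rewrite inE => Qy ->; rewrite (valP y).
by exists (Sub x Px); rewrite ?inE SubK.
Qed.

Lemma eq_from_partial_sums n (f g : nat -> nat) :
  (forall k, k <= n -> \sum_(i < k) f i = \sum_(i < k) g i) ->
  forall i, i < n -> f i = g i.
Proof.
move=> eq_fg i lt_in; have := eq_fg _ lt_in; rewrite !big_ord_recr /=.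
by rewrite eq_fg 1?ltnW // => /addnI.
Qed.

Lemma leq_partial_sums (f : nat -> nat) k l :
  k <= l -> \sum_(i < k) f i <= \sum_(i < l) f i.
Proof. by move=> /subnKC <-; rewrite big_split_ord leq_addr. Qed.

Lemma card_ord_ltn v k : k <= v -> #|[set j : 'I_v | j < k]| = k.
Proof. by move=> le_kv; rewrite -sum1dep_card (big_ord_narrow le_kv) sum1_card card_ord. Qed.

Section OnePermutation.

Variables (v : nat) (pi : 'S_v).

Implicit Types (A : {set 'I_v}) (x y z : 'I_v).

Local Notation pos x := (nat_of_ord ((pi^-1)%g x)).

Lemma pos_inj x y : pos x = pos y :> nat -> x = y.
Proof. by move/val_inj/perm_inj. Qed.

Lemma precedesE x y : precedes pi x y = (pos x < pos y).
Proof. by []. Qed.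

Lemma card_precedes x : #|[set y | precedes pi y x]| = pos x.
Proof.
rewrite -(card_imset _ (@perm_inj _ pi^-1%g)) -[RHS](card_ord_ltn (ltnW (ltn_ord _))).
apply: eq_card => j; rewrite inE; apply/imsetP/idP => [[y]|ltj].
  by rewrite inE => ? ->.
by exists (pi j); rewrite ?inE ?precedesE permK.
Qed.

(** Positions are pairwise distinct, so being covered by [pi] means being sorted
    by position, and a set has one sorted enumeration. *)
Lemma covers_permutations A u :
  u \in permutations (enum A) ->
  covers pi u = (u == sort (relpre (fun x => pos x) leq) (enum A)).
Proof.
rewrite mem_permutations => eq_uA; rewrite /covers.
have tr : transitive (relpre (fun x => pos x) leq) by move=> y x z; apply: leq_trans.
have as_ : antisymmetric (relpre (fun x => pos x) leq).
  by move=> x y /anti_leq /pos_inj.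
have tot : total (relpre (fun x => pos x) leq) by move=> x y; apply: leq_total.
have -> : sorted (precedes pi) u = sorted (relpre (fun x => pos x) leq) u.
  rewrite -[LHS]/(sorted (relpre (fun x => pos x) ltn) u).
  rewrite -!sorted_map ltn_sorted_uniq_leq map_inj_uniq; last exact: pos_inj.
  by rewrite (perm_uniq eq_uA) enum_uniq.
apply/idP/eqP => [su|->]; last exact: sort_sorted.
by apply: (sorted_eq tr as_ su (sort_sorted tot _)); rewrite perm_sym perm_sort perm_sym.
Qed.

Lemma count_covers_permutations A :
  count (covers pi) (permutations (enum A)) = 1.
Proof.
rewrite (eq_in_count (@covers_permutations A)).
rewrite (count_uniq_mem _ (permutations_uniq _)) mem_permutations.
by rewrite perm_sort perm_refl.
Qed.

Definition rank A x := #|[set y in A | precedes pi y x]|.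

Definition gap A (i : nat) := #|[set z in ~: A | rank A z == i]|.

Lemma rank_leq A x z : pos x <= pos z -> rank A x <= rank A z.
Proof.
move=> le_xz; apply/subset_leq_card/subsetP => y; rewrite !inE => /andP[-> /=].
by move=> /leq_trans; apply.
Qed.

Lemma rank_ltn A x z : x \in A -> pos x < pos z -> rank A x < rank A z.
Proof.
move=> Ax lt_xz; apply/proper_card/properP; split.
  apply/subsetP => y; rewrite !inE => /andP[-> /=] /ltn_trans; exact.
by exists x; rewrite inE precedesE ?ltnn ?andbF ?Ax.
Qed.

Lemma sum_gap A k :
  \sum_(i < k) gap A i = #|[set z in ~: A | rank A z < k]|.
Proof.
elim: k => [|k IHk]; first by rewrite big_ord0 eq_card0 // => z; rewrite !inE andbF.
rewrite big_ord_recr {}IHk /gap /= -cardsUI [X in _ + X]eq_card0 ?addn0.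
  by apply: eq_card => z; rewrite !inE -andb_orr orbC -leq_eqVlt.
by move=> z; rewrite !inE; case: ltngtP; rewrite ?andbF.
Qed.

(** No rank exceeds [a], so the first [a + 1] gaps exhaust the complement. *)
Lemma sum_gap_all A a : #|A| = a -> \sum_(i < a.+1) gap A i = v - a.
Proof.
move=> cA; rewrite sum_gap -cA -[X in X - _]card_ord -(cardsC A) addKn.
apply: eq_card => z; rewrite !inE ltnS andbC.
by rewrite subset_leq_card //; apply/subsetP => y; rewrite inE => /andP[].
Qed.

(** A symbol outside [A] precedes [x] exactly when its gap is one of the gaps
    numbered up to the rank of [x]; the other predecessors of [x] are the
    symbols of [A] that its rank counts. *)
Lemma position_of_marked A x : x \in A ->
  pos x = rank A x + \sum_(i < (rank A x).+1) gap A i :> nat.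
Proof.
move=> Ax; rewrite sum_gap -card_precedes -[LHS](cardsID A).
congr (_ + _); apply: eq_card => z.
  by rewrite !inE andbC.
rewrite !inE precedesE.
case Az: (z \in A) => //=; rewrite ltnS.
case: (ltngtP (pos z) (pos x)) => [lt_zx|lt_xz|/pos_inj eq_zx].
- by rewrite rank_leq // ltnW.
- by rewrite leqNgt rank_ltn.
- by rewrite eq_zx Ax in Az.
Qed.

Section PrescribedGaps.

Variables (a : nat) (m : nat -> nat).
Hypotheses (le_av : a <= v) (sum_m : \sum_(i < a.+1) m i = v - a).

Lemma marked_position_proof (i : 'I_a) : i + \sum_(j < i.+1) m j < v.
Proof.
have le_sum : \sum_(j < i.+1) m j <= v - a.
  by rewrite -sum_m leq_partial_sums // ltnS ltnW.
by rewrite -(subnKC le_av) -addSn leq_add.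
Qed.

(** Since [position_of_marked] forces the position of each symbol of a set with
    gap lengths [m], this is the only candidate for its symbol of rank [i]. *)
Definition marked_symbol i : 'I_v := pi (Ordinal (marked_position_proof i)).

Definition marked_set : {set 'I_v} := [set marked_symbol i | i : 'I_a].

Lemma pos_marked_symbol i :
  pos (marked_symbol i) = i + \sum_(j < i.+1) m j :> nat.
Proof. by rewrite permK. Qed.

Lemma pos_marked_symbol_ltn i j :
  (pos (marked_symbol i) < pos (marked_symbol j)) = (i < j).
Proof.
rewrite !pos_marked_symbol.
have mono k l : k < l -> k + \sum_(h < k.+1) m h < l + \sum_(h < l.+1) m h.
  move=> lt_kl; by rewrite -addSn leq_add // leq_partial_sums // ltnW.
case: (ltngtP i j) => [/mono //|/mono lt_ji|->]; last exact: ltnn.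
by rewrite ltnNge ltnW.
Qed.

Lemma marked_symbol_inj : injective marked_symbol.
Proof.
move=> i j eq_ij; apply: val_inj => /=; have := pos_marked_symbol_ltn i j.
have := pos_marked_symbol_ltn j i; rewrite eq_ij ltnn.
by case: ltngtP.
Qed.

Lemma card_marked_set : #|marked_set| = a.
Proof. by rewrite card_imset ?card_ord //; apply: marked_symbol_inj. Qed.

Lemma rank_marked_symbol i : rank marked_set (marked_symbol i) = i.
Proof.
rewrite -[RHS](card_ord_ltn (ltnW (ltn_ord i))) -(card_imset _ marked_symbol_inj).
apply: eq_card => y; rewrite inE; apply/andP/imsetP => [[/imsetP[j _ ->]]|[j]].
  by rewrite precedesE pos_marked_symbol_ltn => lt_ji; exists j; rewrite ?inE.
by rewrite inE => lt_ji ->; rewrite precedesE pos_marked_symbol_ltn imset_f.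
Qed.

(** By [position_of_marked] the partial sums of the gap lengths can be read off
    the positions of the marked symbols, where those of [m] were put; the sum
    of all [a + 1] gaps is [v - a] on both sides. *)
Lemma gap_marked_set i : i < a.+1 -> gap marked_set i = m i.
Proof.
apply: eq_from_partial_sums => -[|k]; first by rewrite !big_ord0.
rewrite ltnS leq_eqVlt => /predU1P[->|lt_ka].
  by rewrite sum_m sum_gap_all ?card_marked_set.
have := position_of_marked (imset_f marked_symbol (isT : Ordinal lt_ka \in 'I_a)).
by rewrite -/marked_set rank_marked_symbol pos_marked_symbol => /addnI ->.
Qed.

(** The gap lengths fix the position of every symbol of [A] in terms of its
    rank, so [A] is contained in [marked_set]; both have [a] elements. *)
Lemma gaps_determine_set A :
  #|A| = a -> (forall i, i < a.+1 -> gap A i = m i) -> A = marked_set.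
Proof.
move=> cA gapA; apply/eqP; rewrite eqEcard card_marked_set cA leqnn andbT.
apply/subsetP => x Ax.
have lt_ra : rank A x < a.
  rewrite -cA; apply/proper_card/properP; split; last by exists x; rewrite // inE precedesE ltnn andbF.
  by apply/subsetP => y; rewrite inE => /andP[].
apply/imsetP; exists (Ordinal lt_ra) => //; apply: pos_inj.
rewrite pos_marked_symbol (position_of_marked Ax) /=; congr (_ + _).
apply: eq_bigr => i _; apply: gapA.
by rewrite ltnS (leq_trans _ (ltnW lt_ra)) // -ltnS.
Qed.

Lemma card_gaps_eq1 :
  #|[set A : {set 'I_v} | (#|A| == a) && [forall i : 'I_a.+1, gap A i == m i]]| = 1.
Proof.
rewrite -(cards1 marked_set); apply: eq_card => A; rewrite !inE.
apply/andP/eqP => [[/eqP cA /forallP gapA]|->].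
  by apply: gaps_determine_set => // i lt_ia; apply/eqP/(gapA (Ordinal lt_ia)).
rewrite card_marked_set eqxx; split=> //.
by apply/forallP => i; rewrite gap_marked_set.
Qed.

End PrescribedGaps.

End OnePermutation.

Lemma multiplicity_vectorE v (X : {set 'S_v}) (A : {set 'I_v}) u a
    (rho : row_index (derived_array X A u)) (i : 'I_a.+1) :
  multiplicity_vector a rho i = gap (val rho) A i.
Proof.
by rewrite ffunE /gap -[RHS](card_set_sig (mem (~: A)) (fun nu => rank (val rho) A nu == i)).
Qed.

Lemma card_rows v (X : {set 'S_v}) (A : {set 'I_v}) u a
    (m : {ffun 'I_a.+1 -> nat}) :
  #|[set rho : row_index (derived_array X A u) | multiplicity_vector a rho == m]|
  = \sum_(pi in X) (covers pi u && [forall i : 'I_a.+1, gap pi A i == m i]).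
Proof.
pose has_gaps pi := [forall i : 'I_a.+1, gap pi A i == m i].
transitivity (\sum_(pi in X | covers pi u && has_gaps pi) 1).
  rewrite sum1dep_card.
  transitivity #|[set pi | (pi \in covering X u) && has_gaps pi]|; last first.
    by apply: eq_card => pi; rewrite !inE andbA.
  rewrite -(card_set_sig (mem (covering X u)) has_gaps).
  apply: eq_card => rho; rewrite !inE.
  apply/eqP/forallP => [<- i|eq_m]; first by rewrite multiplicity_vectorE.
  by apply/ffunP => i; rewrite multiplicity_vectorE; apply/eqP.
by rewrite big_mkcondr; apply: eq_bigr => pi _; case: ifP.
Qed.

Theorem lemma6 (v t : nat) (v_gt0 : 0 < v) (t_gt0 : 0 < t) (le_tv : t <= v)
    (X : {set 'S_v}) (scaX : is_SCA t`! t X)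
    (a : nat) (a_gt0 : 0 < a) (lt_at : a < t)
    (m : {ffun 'I_a.+1 -> nat}) (sum_m : \sum_(i < a.+1) m i = v - a) :
  \sum_(C <- derived_arrays X a)
     #|[set rho : row_index C | multiplicity_vector a rho == m]| = t`!.
Proof.
have [<- _] := scaX; have le_av : a <= v by rewrite ltnW ?(leq_trans lt_at).
rewrite /derived_arrays big_allpairs_dep big_enum /=.
under eq_bigr => A _ do under eq_bigr => u _ do rewrite card_rows.
under eq_bigr => A _ do rewrite exchange_big.
rewrite exchange_big -sum1_card /=; apply: eq_bigr => pi _.
(* Partial sums are easier to form over [nat], so [m] is extended by [inord]. *)
have sum_m' : \sum_(i < a.+1) m (inord i) = v - a.
  by rewrite -sum_m; apply: eq_bigr => i _; rewrite inord_val.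
rewrite -[RHS](@card_gaps_eq1 v pi a (fun i => m (inord i)) le_av sum_m') -sum1dep_card big_mkcondr.
apply: eq_big => [A|A _]; first by rewrite inE.
have -> : [forall i : 'I_a.+1, gap pi A i == m (inord i)]
        = [forall i : 'I_a.+1, gap pi A i == m i].
  by apply: eq_forallb => i; rewrite inord_val.
case: ifP => _; last by rewrite big1 // => u _; rewrite andbF.
(* Only the ordering of [A] that [pi] covers contributes. *)
rewrite -[RHS](count_covers_permutations pi A) -sum1_count [RHS]big_mkcond.
by apply: eq_bigr => u _; rewrite andbT; case: ifP.
Qed.
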